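(* Let $k$ be an algebraically closed field of characteristic zero and let $q \in k$ be a primitive third root of unity. Then $\nu_n(u_q(\mathfrak{sl}_2)) = n^2$ for all integers $n \ge 1$.
   Context: For a finite-dimensional Hopf algebra $H$ with antipode $S$ and $n \ge 1$, $\nu_n(H) = \mathrm{Tr}(S \circ P_H^{(n-1)}: H \to H) \in k$, where $P_H^{(m)}$ is the $m$-th convolution power of $\mathrm{id}_H$ ($P_H^{(0)}(h) = \varepsilon(h)1$, $P_H^{(m)}(h) = h_{(1)}\cdots h_{(m)}$ for $m \ge 1$). For a root of unity $q$ of odd order $N>1$ (here $N=3$), $u_q(\mathfrak{sl}_2)$ is the Hopf algebra generated as an algebra by $E, F, K$ with relations $E^N = F^N = 0$, $K^N = 1$, $KE = q^2EK$, $KF = q^{-2}FK$, $EF - FE = (K - K^{N-1})/(q - q^{-1})$, with $\Delta(E) = E\otimes1 + K\otimes E$, $\Delta(F) = F\otimes K^{-1} + 1\otimes F$, $\Delta(K) = K\otimes K$. *)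

(* Defs.v *)
From HB Require Import structures.
From mathcomp Require Import all_boot all_order all_algebra all_field.

Set Implicit Arguments.
Unset Strict Implicit.
Unset Printing Implicit Defensive.

Import GRing.Theory.
Local Open Scope ring_scope.

Section Tensor.

Variable k : fieldType.
Implicit Types U V W : vectType k.

(* U (x) V is realised as the space of coordinate matrices with respect to the
   bases (vbasis {:U}) and (vbasis {:V}).  Lemmas [tens_is_bilinear],
   [tens_liftE] and [tens_lift_unique] below are its universal property. *)
Notation tensor U V := 'M[k]_(\dim {:U}, \dim {:V}).

Definition tens U V (u : U) (v : V) : tensor U V :=
  \matrix_(i, j) (coord (vbasis {:U}) i u * coord (vbasis {:V}) j v).

Definition bilin U V W (f : U -> V -> W) : Prop :=
  (forall v, linear (f ^~ v)) /\ (forall u, linear (f u)).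

(* The linear map on U (x) V induced by f, meaningful for bilinear f. *)
Definition tens_lift U V W (f : U -> V -> W) (t : tensor U V) : W :=
  \sum_i \sum_j t i j *: f (vbasis {:U})`_i (vbasis {:V})`_j.

Lemma tens_is_bilinear U V : bilin (@tens U V).
Proof.
split=> [v | u] a x y; apply/matrixP=> i j; rewrite !mxE linearP /=.
  by rewrite mulrDl mulrA.
by rewrite mulrDr mulrCA.
Qed.

Lemma tens_lift_is_linear U V W (f : U -> V -> W) : linear (tens_lift f).
Proof.
move=> a s t; rewrite /tens_lift scaler_sumr -big_split; apply: eq_bigr => i _.
rewrite scaler_sumr -big_split; apply: eq_bigr => j _ /=.
by rewrite !mxE scalerDl scalerA.
Qed.

Lemma tens_liftE U V W (f : U -> V -> W) u v :
  bilin f -> tens_lift f (tens u v) = f u v.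
Proof.
case=> fl fr.
pose gl v := GRing.isLinear.Build _ _ _ _ (f ^~ v) (fl v).
pose gr u := GRing.isLinear.Build _ _ _ _ (f u) (fr u).
pose Fl v : {linear U -> W} := HB.pack_for {linear U -> W} (f ^~ v) (gl v).
pose Fr u : {linear V -> W} := HB.pack_for {linear V -> W} (f u) (gr u).
rewrite {2}(coord_vbasis (memvf u)) -[RHS]/(Fl v _) linear_sum.
apply: eq_bigr => i _; rewrite linearZ /= {2}(coord_vbasis (memvf v)).
rewrite -[X in _ *: X]/(Fr _ _) linear_sum scaler_sumr.
by apply: eq_bigr => j _; rewrite linearZ scalerA mxE.
Qed.

Lemma tens_lift_unique U V W (g : {linear tensor U V -> W}) :
  g =1 tens_lift (fun u v => g (tens u v)).
Proof.
move=> t; rewrite /tens_lift {1}(matrix_sum_delta t) linear_sum.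
apply: eq_bigr => i _; rewrite linear_sum; apply: eq_bigr => j _.
rewrite linearZ /=; congr (_ *: g _); apply/matrixP=> a b; rewrite !mxE.
rewrite !coord_free ?(basis_free (vbasisP _)) //.
by rewrite -natrM mulnb (eq_sym a) (eq_sym b).
Qed.

Definition tens_assoc U V W (t : tensor (tensor U V) W) :
    tensor U (tensor V W) :=
  tens_lift
    (fun s w => tens_lift (fun u v => tens u (tens v w)) s) t.

Definition tens_mul (A B : falgType k) (s t : tensor A B) : tensor A B :=
  tens_lift (fun a b => tens_lift (fun c d => tens (a * c) (b * d)) t) s.

Definition lfun_trace V (f : 'End(V)) : k :=
  \tr (\matrix_(i, j) coord (vbasis {:V}) j (f (vbasis {:V})`_i)).

Record is_hopf (H : falgType k) (comul : 'Hom(H, tensor H H))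
    (counit : 'Hom(H, k^o)) (antipode : 'End(H)) : Prop := IsHopf {
  comulA : forall h,
    tens_assoc (tens_lift (fun a b => tens (comul a) b) (comul h))
      = tens_lift (fun a b => tens a (comul b)) (comul h);
  counitl : forall h, tens_lift (fun a b => counit a *: b) (comul h) = h;
  counitr : forall h, tens_lift (fun a b => counit b *: a) (comul h) = h;
  comul1 : comul 1 = tens 1 1;
  comulM : forall g h, comul (g * h) = tens_mul (comul g) (comul h);
  counit1 : counit 1 = 1;
  counitM : forall g h, counit (g * h) = counit g * counit h;
  antipodel : forall h,
    tens_lift (fun a b => antipode a * b) (comul h) = counit h *: 1;
  antipoder : forall h,
    tens_lift (fun a b => a * antipode b) (comul h) = counit h *: 1
}.

Record hopfAlg := HopfAlg {
  hopf_sort :> falgType k;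
  comul : 'Hom(hopf_sort, tensor hopf_sort hopf_sort);
  counit : 'Hom(hopf_sort, k^o);
  antipode : 'End(hopf_sort);
  hopfP : is_hopf comul counit antipode
}.

Section Indicator.

Variable H : hopfAlg.

Definition conv (f g : 'End(H)) : 'End(H) :=
  linfun (fun h : H => tens_lift (fun a b => f a * g b) (comul H h)).

Definition conv1 : 'End(H) := linfun (fun h : H => counit H h *: (1 : H)).

Definition sweedler_pow (m : nat) : 'End(H) := iter m (conv \1%VF) conv1.

(* [linfun] is only meaningful on linear maps; the arguments above are. *)
Lemma convE (f g : 'End(H)) h :
  conv f g h = tens_lift (fun a b => f a * g b) (comul H h).
Proof.
pose c h : H := tens_lift (fun a b => f a * g b) (comul H h).
have cL : linear c.
  by move=> a x y; rewrite /c linearP /= tens_lift_is_linear.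
pose cl := HB.pack_for {linear H -> H} c (GRing.isLinear.Build _ _ _ _ c cL).
exact: (lfunE cl).
Qed.

Lemma conv1E h : conv1 h = counit H h *: 1.
Proof.
pose c h : H := counit H h *: (1 : H).
have cL : linear c.
  by move=> a x y; rewrite /c linearP /= scalerDl scalerA.
pose cl := HB.pack_for {linear H -> H} c (GRing.isLinear.Build _ _ _ _ c cL).
exact: (lfunE cl).
Qed.

(* Only used for 0 < n. *)
Definition nu (n : nat) : k :=
  lfun_trace (antipode H \o sweedler_pow n.-1)%VF.

End Indicator.

Record uq_sl2_relations (N : nat) (q : k) (A : algType k) (E F K : A) : Prop :=
  UqSl2Relations {
  uq_EN : E ^+ N = 0;
  uq_FN : F ^+ N = 0;
  uq_KN : K ^+ N = 1;
  uq_KE : K * E = q ^+ 2 *: (E * K);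
  uq_KF : K * F = q ^- 2 *: (F * K);
  uq_EF : E * F - F * E = (q - q^-1)^-1 *: (K - K ^+ N.-1)
}.

(* A is the k-algebra presented by the generators E, F, K and the relations
   above: it is universal among the algebras with three such elements (which
   in particular forces E, F, K to generate A). *)
Record uq_sl2_presentation (N : nat) (q : k) (A : algType k) (E F K : A)
    : Prop := UqSl2Presentation {
  uq_rel : uq_sl2_relations N q E F K;
  uq_ex : forall (B : algType k) (e f x : B), uq_sl2_relations N q e f x ->
    exists phi : {lrmorphism A -> B}, [/\ phi E = e, phi F = f & phi K = x];
  uq_uniq : forall (B : algType k) (phi psi : {lrmorphism A -> B}),
    phi E = psi E -> phi F = psi F -> phi K = psi K -> phi =1 psi
}.

(* The Hopf algebra H is u_q(sl_2).  The comultiplication is determined by its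
   values on the generators; the counit and the antipode by the axioms. *)
Record is_uq_sl2 (N : nat) (q : k) (H : hopfAlg) (E F K : H) : Prop :=
  IsUqSl2 {
  uq_pres : uq_sl2_presentation N q E F K;
  uq_comulE : comul H E = tens E 1 + tens K E;
  uq_comulF : comul H F = tens F K^-1 + tens 1 F;
  uq_comulK : comul H K = tens K K
}.

End Tensor.

(* Main.v *)
Require Import Defs.
From HB Require Import structures.
From mathcomp Require Import all_boot all_order all_algebra all_field.
From mathcomp Require Import ring zify ssrZ.
From Stdlib Require BinNums.

Set Implicit Arguments.
Unset Strict Implicit.
Unset Printing Implicit Defensive.

Import GRing.Theory.
Local Open Scope ring_scope.

(* With f = (q - q^-1) F, the 27 monomials f^a E^b K^c form a basis: they span
   because their span is a subalgebra containing the generators, and they are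
   independent because they act independently in an explicit 27-dimensional
   module.  In this basis all structure constants lie in Z[q], so the Sweedler
   powers and the antipode can be computed exactly.  The computation shows that
   the identity is annihilated by (x^3 - 1)^3 in the convolution algebra, so
   nu satisfies
     nu(n+9) = 3 nu(n+6) - 3 nu(n+3) + nu(n),
   as does n^2, and the two sequences agree for n = 1, ..., 9. *)

(** * Linear combinations with coefficients in Z[q] *)

(** Linearity is a proposition here, so that functions without a registered structure, such as
    [tens_lift f], qualify. *)
Lemma linear_scale_sum (k : fieldType) (V W : lmodType k) (g : V -> W)
    (I : Type) (r : seq I) (P : pred I) (c : I -> k) (v : I -> V) :
  linear g ->
  g (\sum_(i <- r | P i) c i *: v i) = \sum_(i <- r | P i) c i *: g (v i).
Proof.
move=> gL; pose gl := GRing.isLinear.Build _ _ _ _ g gL.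
pose G : {linear V -> W} := HB.pack_for {linear V -> W} g gl.
by rewrite -[g _]/(G _) linear_sum; apply: eq_bigr => i _; rewrite linearZ.
Qed.

(* The pair (x, y) stands for the Eisenstein integer x + y q. *)
Definition eis : Type := (BinNums.Z * BinNums.Z)%type.
Definition eis_int (z : BinNums.Z) : eis := (z, 0).
(** The product in Z[q], reduced by q^2 = -1 - q. *)
Definition eis_mul (x y : eis) : eis :=
  (x.1 * y.1 - x.2 * y.2, x.1 * y.2 + x.2 * y.1 - x.2 * y.2).
Definition eis_root (n : nat) : eis := iter n (eis_mul (0, 1)) (eis_int 1).

(** Formal sums, not normalised: an index may occur several times, and its coefficients then add
    up. *)
Definition lcomb (I : eqType) : Type := seq (eis * I).

Section LinearCombinations.

Implicit Types I J : eqType.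

Fixpoint lc_insert I (t : eis * I) (s : lcomb I) : lcomb I :=
  if s is u :: s' then
    if t.2 == u.2 then (t.1 + u.1, u.2) :: s' else u :: lc_insert t s'
  else [:: t].

Definition lc_collect I (s : lcomb I) : lcomb I :=
  foldr (@lc_insert I) [::] s.

Definition lc_scale I (c : eis) (s : lcomb I) : lcomb I :=
  [seq (eis_mul c t.1, t.2) | t <- s].

Definition lc_opp I (s : lcomb I) : lcomb I := lc_scale (eis_int (-1)) s.

Definition lc_bind I J (f : I -> lcomb J) (s : lcomb I) : lcomb J :=
  lc_collect (flatten [seq lc_scale t.1 (f t.2) | t <- s]).

Definition lc_vanishes I (s : lcomb I) : bool :=
  all (fun t => t.1 == 0) (lc_collect s).

Definition lc_coef I (i : I) (s : lcomb I) : eis :=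
  foldr (fun t x => if t.2 == i then t.1 + x else x) 0 s.

Definition lc_single I (i : I) : lcomb I := [:: (eis_int 1, i)].

Definition lc_tens I J (s : lcomb I) (t : lcomb J) : lcomb (I * J)%type :=
  flatten [seq [seq (eis_mul u.1 v.1, (u.2, v.2)) | v <- t] | u <- s].

End LinearCombinations.

Section Evaluation.

Variables (k : fieldType) (q : k).
Hypothesis q2E : q ^+ 2 = - 1 - q.

Definition eis_val (x : eis) : k :=
  (int_of_Z x.1)%:~R + (int_of_Z x.2)%:~R * q.

Lemma eis_val0 : eis_val 0 = 0.
Proof. by rewrite /eis_val !raddf0 mul0r addr0. Qed.

Lemma eis_valD x y : eis_val (x + y) = eis_val x + eis_val y.
Proof. by rewrite /eis_val /= !rmorphD /=; ring. Qed.

Lemma eis_valM x y : eis_val (eis_mul x y) = eis_val x * eis_val y.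
Proof.
rewrite /eis_val /= !(rmorphB, rmorphD, rmorphM) /=.
set a := (int_of_Z x.1)%:~R; set b := (int_of_Z x.2)%:~R.
set c := (int_of_Z y.1)%:~R; set d := (int_of_Z y.2)%:~R.
have -> : (a + b * q) * (c + d * q)
          = a * c + (a * d + b * c) * q + b * d * q ^+ 2 by ring.
by rewrite q2E; ring.
Qed.

Lemma eis_val_int z : eis_val (eis_int z) = (int_of_Z z)%:~R.
Proof. by rewrite /eis_val /= raddf0 mul0r addr0. Qed.

Lemma eis_val_nat n : eis_val (eis_int n%:R) = n%:R.
Proof. by rewrite eis_val_int rmorph_nat mulrz_nat. Qed.

Lemma eis_val_root n : eis_val (eis_root n) = q ^+ n.
Proof.
elim: n => [|n IHn]; first by rewrite (eis_val_nat 1).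
rewrite [eis_root _]/= eis_valM IHn exprS; congr (_ * _).
by rewrite /eis_val /= add0r mul1r.
Qed.

Definition lc_val (I : eqType) (V : lmodType k) (b : I -> V)
    (s : lcomb I) : V :=
  \sum_(t <- s) eis_val t.1 *: b t.2.

Section Val.

Variables (I : eqType) (V : lmodType k) (b : I -> V).
Implicit Types s t : lcomb I.

Lemma lc_val_nil : lc_val b [::] = 0.
Proof. exact: big_nil. Qed.

Lemma lc_val_cons c i s :
  lc_val b ((c, i) :: s) = eis_val c *: b i + lc_val b s.
Proof. exact: big_cons. Qed.

Lemma lc_val_cat s t : lc_val b (s ++ t) = lc_val b s + lc_val b t.
Proof. exact: big_cat. Qed.

Lemma lc_val_single i : lc_val b (lc_single i) = b i.
Proof. by rewrite lc_val_cons lc_val_nil addr0 (eis_val_nat 1) scale1r. Qed.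

Lemma lc_val_scale c s : lc_val b (lc_scale c s) = eis_val c *: lc_val b s.
Proof.
rewrite /lc_val big_map scaler_sumr; apply: eq_bigr => t _.
by rewrite eis_valM scalerA.
Qed.

Lemma lc_val_opp s : lc_val b (lc_opp s) = - lc_val b s.
Proof. by rewrite lc_val_scale eis_val_int scaleN1r. Qed.

Lemma lc_val_insert (u : eis * I) s :
  lc_val b (lc_insert u s) = eis_val u.1 *: b u.2 + lc_val b s.
Proof.
case: u => c i; elim: s => [|[d j] s IHs] /=; first exact: lc_val_cons.
case: eqP => [->|_] /=; rewrite !lc_val_cons ?IHs; last by rewrite addrCA.
by rewrite eis_valD scalerDl addrA.
Qed.

Lemma lc_val_collect s : lc_val b (lc_collect s) = lc_val b s.
Proof.
elim: s => [//|[c i] s IHs].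
by rewrite [lc_collect _]/= lc_val_insert IHs lc_val_cons.
Qed.

Lemma lc_val_vanishes s : lc_vanishes s -> lc_val b s = 0.
Proof.
rewrite /lc_vanishes -lc_val_collect => /allP s0.
by rewrite /lc_val big_seq big1 // => t /s0/eqP->; rewrite eis_val0 scale0r.
Qed.

End Val.

Lemma eq_lc_val (I : eqType) (V : lmodType k) (b b' : I -> V) s :
  b =1 b' -> lc_val b s = lc_val b' s.
Proof. by move=> bE; apply: eq_bigr => t _; rewrite bE. Qed.

Lemma linear_lc_val (I : eqType) (V W : lmodType k) (g : V -> W)
    (b : I -> V) s :
  linear g -> g (lc_val b s) = lc_val (g \o b) s.
Proof.
by move=> gL; apply: linear_scale_sum.
Qed.

Lemma lc_val_bind (I J : eqType) (V : lmodType k) (b : J -> V)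
    (f : I -> lcomb J) s :
  lc_val b (lc_bind f s) = lc_val (fun i => lc_val b (f i)) s.
Proof.
rewrite lc_val_collect.
elim: s => [|[c i] s IHs] /=; first by rewrite !lc_val_nil.
by rewrite lc_val_cat lc_val_scale IHs lc_val_cons.
Qed.

(** Once g is known on basis vectors, its value on any combination is computed on coefficient lists
    alone. *)
Lemma linear_lc_bind (I J : eqType) (V W : lmodType k) (g : V -> W)
    (b : I -> V) (b' : J -> W) f s :
  linear g -> (forall i, g (b i) = lc_val b' (f i)) ->
  g (lc_val b s) = lc_val b' (lc_bind f s).
Proof.
by move=> gL gb; rewrite linear_lc_val // lc_val_bind; apply: eq_lc_val.
Qed.

Lemma lc_val_coef (I : eqType) (V : lmodType k) (b : I -> V)
    (d : V -> k^o) i s :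
  linear d -> (forall j, d (b j) = (j == i)%:R) ->
  d (lc_val b s) = eis_val (lc_coef i s).
Proof.
move=> dL db; rewrite linear_lc_val //; elim: s => [|[c j] s IHs] /=.
  by rewrite lc_val_nil eis_val0.
rewrite lc_val_cons IHs /= db; case: (j == i); last by rewrite scaler0 add0r.
by rewrite eis_valD [_ *: _]mulr1.
Qed.

Lemma lc_val_tens (I J : eqType) (U V : vectType k) (b : I -> U)
    (b' : J -> V) s t :
  lc_val (fun p => tens (b p.1) (b' p.2)) (lc_tens s t)
  = tens (lc_val b s) (lc_val b' t).
Proof.
have [tl tr] := tens_is_bilinear U V.
rewrite (linear_lc_val (g := (@tens k U V)^~ _)) //.
elim: s => [|[c i] s IHs]; first by rewrite !lc_val_nil.
rewrite [lc_tens _ _]/= lc_val_cat IHs lc_val_cons; congr (_ + _) => /=.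
rewrite (linear_lc_val (g := tens (b i))) // /lc_val big_map scaler_sumr.
by apply: eq_bigr => u _; rewrite /= eis_valM scalerA.
Qed.

End Evaluation.

(** * Straightening into monomials *)

(* (a, b, c) indexes the monomial f^a E^b K^c, where f = (q - q^-1) F; the
   rescaling makes E f - f E = K - K^2, so that all structure constants are
   Eisenstein integers. *)
Definition idx : Type := ('I_3 * 'I_3 * 'I_3)%type.

Definition idx1 : idx := (0, 0, 0).

(** Moving K past f costs q^-2 = q and past E costs q^2. The sum [c + 1] wraps around in ['I_3], in
    accordance with K^3 = 1. *)
Definition mulK (i : idx) : lcomb idx :=
  let: (a, b, c) := i in [:: (eis_root (a + 2 * b), (a, b, c + 1))].

Definition mulF (i : idx) : lcomb idx :=
  let: (a, b, c) := i in if a == 2 then [::] else lc_single (a + 1, b, c).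

(** For w = E^b K^c, the recursion is E f^(a+1) w = f (E f^a w) + K f^a w - K^2 f^a w, from E f = f
    E + K - K^2. *)
Fixpoint mulE_rec (a : nat) (b c : 'I_3) : lcomb idx :=
  if a is a'.+1 then
    let u := lc_single (inZp a', b, c) in
    lc_bind mulF (mulE_rec a' b c)
      ++ lc_bind mulK u ++ lc_opp (lc_bind mulK (lc_bind mulK u))
  else if b == 2 then [::] else lc_single (0, b + 1, c).

Lemma mulE_recS a b c (u : lcomb idx := lc_single (inZp a, b, c)) :
  mulE_rec a.+1 b c = lc_bind mulF (mulE_rec a b c)
    ++ lc_bind mulK u ++ lc_opp (lc_bind mulK (lc_bind mulK u)).
Proof. by []. Qed.

Definition mulE (i : idx) : lcomb idx :=
  let: (a, b, c) := i in mulE_rec a b c.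

Definition mulmon (i : idx) (s : lcomb idx) : lcomb idx :=
  let: (a, b, c) := i in
  iter a (lc_bind mulF) (iter b (lc_bind mulE) (iter c (lc_bind mulK) s)).

Section Straightening.

Variables (k : fieldType) (q : k) (A : algType k) (E F K : A).
Hypothesis q2E : q ^+ 2 = - 1 - q.

(** In this section [F] stands for the rescaled generator f, and q^-2 is written as q. *)
Record rescaled_relations : Prop := RescaledRelations {
  rr_E3 : E ^+ 3 = 0;
  rr_F3 : F ^+ 3 = 0;
  rr_K3 : K ^+ 3 = 1;
  rr_KE : K * E = q ^+ 2 *: (E * K);
  rr_KF : K * F = q *: (F * K);
  rr_EF : E * F = F * E + K - K ^+ 2
}.

Definition mon (i : idx) : A := F ^+ i.1.1 * E ^+ i.1.2 * K ^+ i.2.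

Lemma mulrX_scale (x y : A) (c : k) n :
  x * y = c *: (y * x) -> x * y ^+ n = c ^+ n *: (y ^+ n * x).
Proof.
move=> xy; elim: n => [|n IHn]; first by rewrite mulr1 mul1r scale1r.
rewrite exprS mulrA xy -scalerAl -[y * x * _]mulrA IHn -scalerAr scalerA mulrA.
by rewrite [c ^+ n.+1]exprS.
Qed.

Lemma ordS3 (a : 'I_3) : a != 2 -> (a + 1 : 'I_3) = a.+1 :> nat.
Proof. by case: a => [[|[|[|a]]] lt_a]. Qed.

Lemma mull_linear (x : A) : linear ( *%R x).
Proof. by move=> c u v; rewrite mulrDr scalerAr. Qed.

Hypothesis rels : rescaled_relations.

Notation val := (lc_val q mon).

Lemma mon1 : mon idx1 = 1.
Proof. by rewrite /mon !mulr1. Qed.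

Lemma mulK_mon i : K * mon i = val (mulK i).
Proof.
case: i => [[a b] c]; rewrite lc_val_cons lc_val_nil addr0 eis_val_root //.
rewrite /mon /= !mulrA (mulrX_scale _ (rr_KF rels)) -scalerAl -(mulrA _ K).
rewrite (mulrX_scale _ (rr_KE rels)) -scalerAr -!scalerAl scalerA -exprM -exprD.
by congr (_ *: _); rewrite (expr_mod _ (rr_K3 rels)) addn1 exprS !mulrA.
Qed.

Lemma mulF_mon i : F * mon i = val (mulF i).
Proof.
case: i => [[a b] c]; rewrite /mulF /mon /= !mulrA -exprS.
case: eqP => [->|/eqP a2]; first by rewrite lc_val_nil (rr_F3 rels) !mul0r.
by rewrite lc_val_single /mon /= -ordS3.
Qed.

Lemma mulr_lc_val x (y : idx -> lcomb idx) s :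
  (forall i, x * mon i = val (y i)) -> x * val s = val (lc_bind y s).
Proof. by move=> xy; apply: linear_lc_bind => //; apply: mull_linear. Qed.

Lemma mulE_mon i : E * mon i = val (mulE i).
Proof.
case: i => [[a b] c]; rewrite /mulE.
rewrite {1}/mon [(_, _, _).1.1]/= [(_, _, _).1.2]/= [(_, _, _).2]/=.
(* The exponent of f becomes a natural number below 3, since [mulE_rec] recurses on it. *)
move: (nat_of_ord a) (ltn_ord a) => {}a.
elim: a => [|a IHa] lt_a.
  rewrite /mulE_rec mul1r mulrA -exprS.
  case: eqP => [->|/eqP b2]; first by rewrite lc_val_nil (rr_E3 rels) !mul0r.
  by rewrite lc_val_single /mon /= mul1r -ordS3.
have a_val : F ^+ a * E ^+ b * K ^+ c = mon (inZp a, b, c).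
  by rewrite /mon /= modn_small // ltnW.
have -> : E * (F ^+ a.+1 * E ^+ b * K ^+ c)
    = F * (E * (F ^+ a * E ^+ b * K ^+ c)) + (K * mon (inZp a, b, c)
      - K * (K * mon (inZp a, b, c))).
  rewrite -a_val exprS !mulrA (rr_EF rels) expr2 !mulrDl !mulNr.
  by rewrite addrA.
rewrite IHa 1?ltnW // mulE_recS !lc_val_cat lc_val_opp //.
rewrite (mulr_lc_val _ mulF_mon) -(lc_val_single q mon (inZp a, b, c)).
by rewrite !(mulr_lc_val _ mulK_mon).
Qed.

Lemma mulX_lc_val x (y : idx -> lcomb idx) s n :
  (forall i, x * mon i = val (y i)) ->
  x ^+ n * val s = val (iter n (lc_bind y) s).
Proof.
move=> xy; elim: n => [|n IHn]; first by rewrite mul1r.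
by rewrite exprS -mulrA IHn (mulr_lc_val _ xy).
Qed.

Lemma mulmon_val i s : mon i * val s = val (mulmon i s).
Proof.
case: i => [[a b] c]; rewrite /mon /= -!mulrA.
rewrite (mulX_lc_val _ _ mulK_mon) (mulX_lc_val _ _ mulE_mon).
exact: mulX_lc_val mulF_mon.
Qed.

End Straightening.

(** * The regular module and the monomial basis *)

(** A concrete list of the 27 indices, over which boolean checks evaluate by [vm_compute]. *)
Definition all_idx : seq idx :=
  let r : seq 'I_3 := [:: 0; 1; 2] in
  [seq (p, c) | p <- [seq (a, b) | a <- r, b <- r], c <- r].

Lemma all_idxP (P : pred idx) : all P all_idx -> forall i, P i.
Proof.
move=> /allP allP i; apply: allP.
by case: i => [[[[|[|[|//]]] ?] [[|[|[|//]]] ?]] [[|[|[|//]]] ?]].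
Qed.

(** * Primitive cube roots of unity and the rescaling of F *)

Section Rescaling.

Variables (k : fieldType) (q : k).
Hypothesis hq : 3.-primitive_root q.

Lemma prim3_q3 : q ^+ 3 = 1. Proof. exact: prim_expr_order hq. Qed.

Lemma prim3_neq1 : q != 1.
Proof. by rewrite -[q]expr1 -(prim_order_dvd hq). Qed.

Lemma prim3_neq0 : q != 0.
Proof.
apply/eqP=> q0; have := prim3_q3.
by rewrite q0 expr0n => /eqP; rewrite eq_sym oner_eq0.
Qed.

Lemma prim3_sqr : q ^+ 2 = - 1 - q.
Proof.
have /eqP : (q - 1) * (q ^+ 2 + q + 1) = 0.
  by transitivity (q ^+ 3 - 1); [ring | rewrite prim3_q3 subrr].
rewrite mulf_eq0 subr_eq0 (negPf prim3_neq1) /= => /eqP q2.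
by rewrite -[RHS]addr0 -q2; ring.
Qed.

Lemma prim3_invr : q^-1 = q ^+ 2.
Proof.
by apply: (mulfI prim3_neq0); rewrite -exprS prim3_q3 divff ?prim3_neq0.
Qed.

Lemma prim3_invr2 : q ^- 2 = q.
Proof. by rewrite -prim3_invr invrK. Qed.

(** Since q^-1 = q^2, the difference is q (1 - q). This makes the passage from F to f invertible. *)
Lemma prim3_sub_neq0 : q - q^-1 != 0.
Proof.
rewrite prim3_invr subr_eq0 -{1}[q]mulr1 expr2.
by rewrite (inj_eq (mulfI prim3_neq0)) eq_sym prim3_neq1.
Qed.

Lemma rescale_relations (A : algType k) (E F K : A) :
  uq_sl2_relations 3 q E F K ->
  rescaled_relations q E ((q - q^-1) *: F) K.
Proof.
case=> E3 F3 K3 KE KF EF; split=> //.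
- by rewrite exprZn F3 scaler0.
- by rewrite -scalerAr KF -scalerAl !scalerA mulrC prim3_invr2.
- rewrite -scalerAr -scalerAl -addrA; apply/eqP.
  rewrite addrC -subr_eq -scalerBr EF.
  by rewrite scalerA divff ?prim3_sub_neq0 // scale1r.
Qed.

(** Brings the matrix model back to the original relations, so that the universal property of the
    presentation applies to it. *)
Lemma unscale_relations (A : algType k) (E F K : A) :
  rescaled_relations q E F K ->
  uq_sl2_relations 3 q E ((q - q^-1)^-1 *: F) K.
Proof.
case=> E3 F3 K3 KE KF EF; split=> //.
- by rewrite exprZn F3 scaler0.
- by rewrite -scalerAr KF -scalerAl !scalerA mulrC prim3_invr2.
- rewrite -scalerAr -scalerAl -scalerBr EF.
  by rewrite -(addrA (F * E)) [F * E + _]addrC addrK.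
Qed.

End Rescaling.

(** * A model by 27 x 27 matrices *)

Section RegularModel.

Variables (k : fieldType) (q : k).
Hypothesis q2E : q ^+ 2 = - 1 - q.

Lemma card_idx : #|{: idx}| = 27.
Proof. by rewrite !card_prod card_ord. Qed.

Definition enc (i : idx) : 'I_27 := cast_ord card_idx (enum_rank i).
Definition dec (r : 'I_27) : idx := enum_val (cast_ord (esym card_idx) r).

Lemma encK : cancel enc dec.
Proof. by move=> i; rewrite /enc /dec cast_ordK enum_rankK. Qed.

Lemma decK : cancel dec enc.
Proof. by move=> i; rewrite /enc /dec enum_valK cast_ordKV. Qed.

Definition col_idx (i : idx) : 'cV[k]_27 := delta_mx (enc i) 0.

Notation val := (lc_val q col_idx).

Definition op_mx (f : idx -> lcomb idx) : 'M[k]_27 :=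
  \matrix_(r, c) val (f (dec c)) r 0.

Lemma op_mx_col f i : op_mx f *m col_idx i = val (f i).
Proof. by rewrite -colE; apply/colP => r; rewrite !mxE encK. Qed.

Lemma op_mx_val f s : op_mx f *m val s = val (lc_bind f s).
Proof.
apply: linear_lc_bind => // [c u v|i]; last exact: op_mx_col.
by rewrite mulmxDr scalemxAr.
Qed.

Lemma col_idx_ext (M N : 'M[k]_27) :
  (forall i, M *m col_idx i = N *m col_idx i) -> M = N.
Proof.
move=> MN; apply/matrixP=> r c.
by have /colP/(_ r) := MN (dec c); rewrite -!colE !mxE decK.
Qed.

(** Reduces a family of vector identities over k to one boolean computation with Eisenstein
    integers, in which k and q do not occur. *)
Lemma lc_val_check (f g : idx -> lcomb idx) :
  all (fun i => lc_vanishes (f i ++ lc_opp (g i))) all_idx ->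
  forall i, val (f i) = val (g i).
Proof.
move=> /all_idxP fg i; apply/eqP; rewrite -subr_eq0 -lc_val_opp // -lc_val_cat.
by rewrite lc_val_vanishes // fg.
Qed.

(** Matrices are compared on the 27 basis vectors, where both sides become coefficient lists built
    from [mulE], [mulF] and [mulK]; each relation is then a finite computation. *)
Lemma model_relations :
  rescaled_relations q (op_mx mulE) (op_mx mulF) (op_mx mulK).
Proof.
have mul2 (x y : 'M[k]_27) (v : 'cV[k]_27) : (x * y) *m v = x *m (y *m v).
  by rewrite -!mulmxE !mulmxA.
have mul3 (x : 'M[k]_27) (v : 'cV[k]_27) : x ^+ 3 *m v = x *m (x *m (x *m v)).
  by rewrite !exprS expr0 mulr1 !mul2.
split; apply: col_idx_ext => i.
- rewrite mul3 op_mx_col !op_mx_val mul0mx -(lc_val_nil q col_idx).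
  apply: lc_val_check (fun j => lc_bind mulE (lc_bind mulE (mulE j)))
    (fun=> [::]) _ i.
  by vm_compute.
- rewrite mul3 op_mx_col !op_mx_val mul0mx -(lc_val_nil q col_idx).
  apply: lc_val_check (fun j => lc_bind mulF (lc_bind mulF (mulF j)))
    (fun=> [::]) _ i.
  by vm_compute.
- rewrite mul3 op_mx_col !op_mx_val mul1mx -(lc_val_single q col_idx).
  apply: lc_val_check (fun j => lc_bind mulK (lc_bind mulK (mulK j)))
    (fun j => lc_single j) _ i.
  by vm_compute.
- rewrite mul2 -scalemxAl mul2 !op_mx_col !op_mx_val.
  rewrite -eis_val_root // -lc_val_scale //.
  apply: lc_val_check (fun j => lc_bind mulK (mulE j))
    (fun j => lc_scale (eis_root 2) (lc_bind mulE (mulK j))) _ i.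
  by vm_compute.
- rewrite mul2 -scalemxAl mul2 !op_mx_col !op_mx_val.
  rewrite -{2}[q]expr1 -eis_val_root // -lc_val_scale //.
  apply: lc_val_check (fun j => lc_bind mulK (mulF j))
    (fun j => lc_scale (eis_root 1) (lc_bind mulF (mulK j))) _ i.
  by vm_compute.
- rewrite expr2 mulmxBl mulmxDl !mul2 !op_mx_col !op_mx_val.
  rewrite -lc_val_opp // -!lc_val_cat.
  apply: lc_val_check (fun j => lc_bind mulE (mulF j))
    (fun j => (lc_bind mulF (mulE j) ++ mulK j)
      ++ lc_opp (lc_bind mulK (mulK j))) _ i.
  by vm_compute.
Qed.

Lemma op_mxX_val f n s :
  op_mx f ^+ n *m val s = val (iter n (lc_bind f) s).
Proof.
elim: n => [|n IHn]; first by rewrite mul1mx.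
by rewrite exprS -mulmxE -mulmxA IHn op_mx_val.
Qed.

(** The source of linear independence: applied to one fixed vector, the 27 monomials give the 27
    distinct basis vectors. *)
Lemma model_mon i :
  mon (op_mx mulE) (op_mx mulF) (op_mx mulK) i *m col_idx idx1 = col_idx i.
Proof.
transitivity (val (mulmon i (lc_single idx1))).
  case: i => [[a b] c]; rewrite /mon /mulmon -!mulmxE -!mulmxA.
  by rewrite -(lc_val_single q col_idx) !op_mxX_val.
rewrite -[RHS](lc_val_single q col_idx); move: i; apply: lc_val_check.
by vm_compute.
Qed.

End RegularModel.

(** * The monomial basis of the presented algebra *)

Section Basis.

Variables (k : fieldType) (q : k) (A : falgType k) (E F K : A).
Hypothesis hq : 3.-primitive_root q.
Hypothesis pres : uq_sl2_presentation 3 q E F K.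

Let f : A := (q - q^-1) *: F.
Let q2E := prim3_sqr hq.
Let rels : rescaled_relations q E f K := rescale_relations hq (uq_rel pres).

Notation mon := (mon E f K).

(* The homomorphism from A onto a unital subalgebra W containing the generators,
   composed with the inclusion, is the identity, so W = A. *)
Lemma presented_subalgebra_full (W : {aspace A}) :
  1 \in W -> E \in W -> F \in W -> K \in W -> forall v, v \in W.
Proof.
(* The unit of [subvs_of W] is [algid W]; the membership of 1 identifies it with the unit of A. *)
rewrite -algid_eq1 => /eqP W1 WE WF WK v.
pose e : subvs_of W := Subvs WE; pose g : subvs_of W := Subvs WF.
pose x : subvs_of W := Subvs WK.
have valX (u : subvs_of W) n : vsval (u ^+ n) = vsval u ^+ n.
  by elim: n => [|n IHn]; [exact: W1 | rewrite !exprS -IHn].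
have [E3 F3 K3 KE KF EF] := uq_rel pres.
have rW : uq_sl2_relations 3 q e g x.
  by split; apply: val_inj; rewrite /= ?valX // W1.
have [phi [phiE phiF phiK]] := uq_ex pres rW.
pose i v : A := vsval (phi v).
have iL : linear i by move=> c u w; rewrite /i linearP.
have iM : monoid_morphism i.
  by split=> [|u w]; rewrite /i ?rmorph1 ?rmorphM.
pose il := GRing.isLinear.Build _ _ _ _ i iL.
pose im := GRing.isMonoidMorphism.Build _ _ i iM.
pose I : {lrmorphism A -> A} := HB.pack_for {lrmorphism A -> A} i il im.
pose id_l : {lrmorphism A -> A} := idfun.
have -> : v = vsval (phi v).
  by apply: (uq_uniq pres (phi := id_l) (psi := I));
    rewrite /= /i ?phiE ?phiF ?phiK.
exact: subvsP.
Qed.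

Let mon_tuple : #|{: idx}|.-tuple A := map_tuple mon (enum_tuple {: idx}).

Let mem_mon i : mon i \in <<mon_tuple>>%VS.
Proof. by apply/memv_span/map_f; rewrite mem_enum. Qed.

Let mem_lc_val s : lc_val q mon s \in <<mon_tuple>>%VS.
Proof. by apply: rpred_sum => t _; apply: rpredZ. Qed.

Let mul_mem_span x y v : (forall i, x * mon i = lc_val q mon (y i)) ->
  v \in <<mon_tuple>>%VS -> x * v \in <<mon_tuple>>%VS.
Proof.
move=> xy /coord_span->; rewrite mulr_sumr; apply: rpred_sum => i _.
rewrite -scalerAr rpredZ // -tnth_nth tnth_map xy; exact: mem_lc_val.
Qed.

(** By the straightening rules the span is stable under left multiplication by f, E and K, hence by
    every monomial, hence it is closed under products. *)
Lemma mem_mon_span v : v \in <<mon_tuple>>%VS.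
Proof.
have W1 : 1 \in <<mon_tuple>>%VS by rewrite -(mon1 E f K).
have mulK x := mul_mem_span (v := x) (mulK_mon q2E rels).
have mulE x := mul_mem_span (v := x) (mulE_mon q2E rels).
have mulF x := mul_mem_span (v := x) (mulF_mon rels).
have mulX x n w :
    (forall u, u \in <<mon_tuple>>%VS -> x * u \in <<mon_tuple>>%VS) ->
    w \in <<mon_tuple>>%VS -> x ^+ n * w \in <<mon_tuple>>%VS.
  by move=> xW wW; elim: n => [|n IHn]; rewrite ?mul1r // exprS -mulrA xW.
have WW : is_aspace <<mon_tuple>>%VS.
  rewrite /is_aspace has_algid1 //; apply/prodvP => u w.
  move=> /coord_span-> wW; rewrite mulr_suml; apply: rpred_sum => i _.
  rewrite -scalerAl rpredZ // -tnth_nth tnth_map /mon -!mulrA.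
  exact: mulX mulF (mulX _ _ _ mulE (mulX _ _ _ mulK wW)).
apply: (presented_subalgebra_full (W := ASpace WW)) => //=.
- by have := mulE 1 W1; rewrite mulr1.
(* F is recovered from f by undoing the rescaling. *)
- have /(rpredZ (q - q^-1)^-1) := mulF 1 W1.
  by rewrite mulr1 scalerA mulVf ?scale1r // prim3_sub_neq0.
- by have := mulK 1 W1; rewrite mulr1.
Qed.

Lemma mon_coordinates : exists d : idx -> A -> k^o,
  [/\ forall i, linear (d i), forall i j, d i (mon j) = (j == i)%:R
    & forall v, v = \sum_i d i v *: mon i].
Proof.
have [phi [phiE phiF phiK]] :=
  uq_ex pres (unscale_relations hq (model_relations q2E)).
have phif : phi f = op_mx q mulF.
  by rewrite linearZ /= phiF scalerA divff ?scale1r // prim3_sub_neq0.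
(* The coordinate functionals: let v act in the matrix model on the basis vector of the monomial 1,
   and read off entry i. *)
pose d i v : k^o := (phi v *m col_idx k idx1) (enc i) 0.
have dL i : linear (d i).
  by move=> c u v; rewrite /d linearP mulmxDl -scalemxAl !mxE.
have dmon i j : d i (mon j) = (j == i)%:R.
  rewrite /d !rmorphM !rmorphXn /= phiE phif phiK model_mon // mxE.
  by rewrite (can_eq encK) eqxx andbT eq_sym.
have dsum i n (c : 'I_n -> k) (g : 'I_n -> A) :
    d i (\sum_r c r *: g r) = \sum_r c r * d i (g r).
  rewrite /d linear_sum mulmx_suml summxE; apply: eq_bigr => r _.
  by rewrite linearZ -scalemxAl mxE.
exists d; split=> // v; rewrite (coord_span (mem_mon_span v)).
under [RHS]eq_bigr => i _ do rewrite dsum scaler_suml.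
rewrite exchange_big; apply: eq_bigr => r _ /=.
rewrite (bigD1 (tnth (enum_tuple {: idx}) r)) //= big1 ?addr0.
  by rewrite -tnth_nth tnth_map dmon eqxx mulr1.
move=> i /negPf ir.
by rewrite -tnth_nth tnth_map dmon eq_sym ir mulr0 scale0r.
Qed.

End Basis.

(** * Tensors, convolution and traces *)

Notation tensor U V := 'M_(\dim {:U}, \dim {:V}).

Section TensorLemmas.

Variable k : fieldType.
Implicit Types U V W : vectType k.

Lemma linear_tens_lift U V W W' (g : W -> W') (f : U -> V -> W) t :
  linear g -> g (tens_lift f t) = tens_lift (fun u v => g (f u v)) t.
Proof.
move=> gL; rewrite /tens_lift.
under eq_bigr => i _ do rewrite -[\sum_j _]scale1r.
rewrite linear_scale_sum //; apply: eq_bigr => i _.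
by rewrite scale1r linear_scale_sum.
Qed.

Lemma eq_tens_lift U V W (f g : U -> V -> W) t :
  (forall u v, f u v = g u v) -> tens_lift f t = tens_lift g t.
Proof.
by move=> fg; apply: eq_bigr => i _; apply: eq_bigr => j _; rewrite fg.
Qed.

Lemma tens_lift_lin U V W c (f g : U -> V -> W) t :
  tens_lift (fun u v => c *: f u v + g u v) t
  = c *: tens_lift f t + tens_lift g t.
Proof.
rewrite /tens_lift scaler_sumr -big_split; apply: eq_bigr => i _.
rewrite scaler_sumr -big_split; apply: eq_bigr => j _ /=.
by rewrite scalerDr !scalerA mulrC.
Qed.

Lemma bilin_mul (A : falgType k) U V (f : U -> A) (g : V -> A) :
  linear f -> linear g -> bilin (fun u v => f u * g v).
Proof.
move=> fL gL; split=> [v|u] c x y.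
  by rewrite fL mulrDl scalerAl.
by rewrite gL mulrDr scalerAr.
Qed.

Lemma tensZl U V c (u : U) (v : V) : tens (c *: u) v = c *: tens u v.
Proof. by apply/matrixP=> i j; rewrite !mxE linearZ mulrA. Qed.

Lemma tensZr U V c (u : U) (v : V) : tens u (c *: v) = c *: tens u v.
Proof. by apply/matrixP=> i j; rewrite !mxE linearZ mulrCA. Qed.

Lemma tens_mulE (A B : falgType k) (a c : A) (b d : B) :
  tens_mul (tens a b) (tens c d) = tens (a * c) (b * d).
Proof.
have [tl tr] := tens_is_bilinear A B.
rewrite /tens_mul !tens_liftE //; split=> [v|u] e x y.
- by rewrite mulrDr -scalerAr tl.
- by rewrite mulrDr -scalerAr tr.
- rewrite -tens_lift_lin; apply: eq_tens_lift => u w.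
  by rewrite mulrDl -scalerAl tl.
- rewrite -tens_lift_lin; apply: eq_tens_lift => u' w.
  by rewrite mulrDl -scalerAl tr.
Qed.

Lemma tens_mul_linearr (A B : falgType k) (s : tensor A B) :
  linear (tens_mul s).
Proof.
move=> c x y; rewrite /tens_mul -tens_lift_lin; apply: eq_tens_lift => u v.
exact: tens_lift_is_linear.
Qed.

Lemma tens_mulDl (A B : falgType k) (s t u : tensor A B) :
  tens_mul (s + t) u = tens_mul s u + tens_mul t u.
Proof.
by rewrite -[s]scale1r [LHS]tens_lift_is_linear !scale1r.
Qed.

End TensorLemmas.

(** * Uniqueness of the antipode, convolution and traces in coordinates *)

Section HopfLemmas.

Variables (k : fieldType) (H : hopfAlg k).

Let hopf := hopfP H.

(* S = S * (id * T) = (S * id) * T = T in the convolution algebra. *)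
Lemma antipode_unique (T : 'End(H)) :
  (forall h, conv \1%VF T h = counit H h *: 1) -> antipode H =1 T.
Proof.
move=> Tr h; set S := antipode H.
have lin (g : 'End(H)) : linear g by move=> c x y; rewrite linearP.
have mulL (x : H) : linear ( *%R x) by move=> c y z; rewrite mulrDr scalerAr.
have mulR (x : H) : linear ( *%R^~ x) by move=> c y z; rewrite mulrDl scalerAl.
(* [tens_lift m] sends a (x) (b (x) c) to S(a) b T(c); both bracketings of the iterated coproduct of
   h are pushed through it. *)
pose m (a : H) (x : tensor H H) : H :=
  tens_lift (fun b c => S a * (b * T c)) x.
have m_bilin : bilin m.
  split=> [x|a] c y z; last exact: tens_lift_is_linear.
  rewrite /m -tens_lift_lin; apply: eq_tens_lift => u v.
  by rewrite linearP /= mulrDl scalerAl.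
have mE a b c : m a (tens b c) = S a * b * T c.
  rewrite /m tens_liftE ?mulrA //; split=> [v|u] e x y.
    by rewrite mulrDl mulrDr -scalerAl -scalerAr.
  by rewrite linearP /= !mulrDr -!scalerAr.
have mD a b : m a (comul H b) = counit H b *: S a.
  rewrite /m -(linear_tens_lift (g := *%R (S a)) (fun b c => b * T c)) //.
  have /(_ b) := Tr; rewrite convE => TrE.
  rewrite -[RHS]mulr1 -scalerAl scalerAr -TrE; congr (_ * _).
  by apply: eq_tens_lift => u v; rewrite lfunE.
have linM : linear (tens_lift m) by apply: tens_lift_is_linear.
(* Read as S * (id * T), the middle term collapses to S(h) by [mD] and the counit; after
   coassociativity, read as (S * id) * T, it collapses to T(h). *)
transitivity
  (tens_lift m (tens_lift (fun a b => tens a (comul H b)) (comul H h))).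
  rewrite linear_tens_lift // -{1}[h](counitr hopf) linear_tens_lift //.
  by apply: eq_tens_lift => a b; rewrite tens_liftE // mD linearZ.
rewrite -(comulA hopf) /tens_assoc linear_tens_lift //.
rewrite linear_tens_lift; last exact: tens_lift_is_linear.
rewrite -[in RHS](counitl hopf h) [in RHS]linear_tens_lift //.
apply: eq_tens_lift => a b.
have redE s c : tens_lift m (tens_lift (fun u v => tens u (tens v c)) s)
    = tens_lift (fun u v => S u * v) s * T c.
  rewrite linear_tens_lift // (linear_tens_lift (g := *%R^~ (T c))) //.
  by apply: eq_tens_lift => u v; rewrite tens_liftE.
rewrite tens_liftE; last first.
  split=> [v|s] c x y; rewrite !redE.
    by rewrite tens_lift_is_linear mulrDl -scalerAl.
  by rewrite linearP /= mulrDr -scalerAr.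
by rewrite redE (antipodel hopf) -scalerAl mul1r linearZ.
Qed.

Lemma conv_lc_val (I : eqType) (q : k) (b c : I -> H)
    (D : lcomb (I * I)%type) (g : 'End(H)) h :
  comul H h = lc_val q (fun p => tens (b p.1) (c p.2)) D ->
  conv \1%VF g h = lc_val q (fun p => b p.1 * g (c p.2)) D.
Proof.
move=> hD; rewrite convE hD linear_lc_val; last exact: tens_lift_is_linear.
apply: eq_lc_val => p /=; rewrite tens_liftE ?lfunE //.
by apply: bilin_mul => e x y; rewrite linearP.
Qed.

(** The expansion writes g as the sum of the maps v |-> d_i(g v) b_i, and such a map has trace d_i(g
    b_i). *)
Lemma lfun_traceE (V : vectType k) (I : finType) (b : I -> V)
    (d : I -> V -> k^o) (g : 'End(V)) :
  (forall i, linear (d i)) -> (forall v, v = \sum_i d i v *: b i) ->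
  lfun_trace g = \sum_i d i (g (b i)).
Proof.
move=> dL vE; rewrite /lfun_trace /mxtrace.
pose e := vbasis {:V}.
transitivity (\sum_(r < \dim {:V}) \sum_i d i (g e`_r) * coord e r (b i)).
  apply: eq_bigr => r _; rewrite mxE {1}(vE (g _)) linear_sum.
  by apply: eq_bigr => i _; rewrite linearZ.
rewrite exchange_big; apply: eq_bigr => i _ /=.
rewrite {2}(coord_vbasis (memvf (b i))) linear_sum /=.
under [in RHS]eq_bigr => r _ do rewrite linearZ /=.
by rewrite linear_scale_sum //; apply: eq_bigr => r _; rewrite mulrC.
Qed.

End HopfLemmas.

(** * The Hopf structure in the monomial basis *)

(* Left multiplications by the coproducts of the generators on monomials
   m (x) m'; note K^-1 = K^2. *)
Definition mulDK (p : idx * idx) : lcomb (idx * idx)%type :=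
  lc_tens (mulK p.1) (mulK p.2).

Definition mulDE (p : idx * idx) : lcomb (idx * idx)%type :=
  lc_tens (mulE p.1) (lc_single p.2) ++ lc_tens (mulK p.1) (mulE p.2).

Definition mulDF (p : idx * idx) : lcomb (idx * idx)%type :=
  lc_tens (mulF p.1) (lc_bind mulK (mulK p.2))
    ++ lc_tens (lc_single p.1) (mulF p.2).

Definition comul_mon (i : idx) : lcomb (idx * idx)%type :=
  let: (a, b, c) := i in
  iter a (lc_bind mulDF) (iter b (lc_bind mulDE) (iter c (lc_bind mulDK)
    (lc_single (idx1, idx1)))).

(** Tabulates the map h |-> counit(h) 1, the unit of the convolution algebra, rather than the scalar
    counit. *)
Definition counit_mon (i : idx) : lcomb idx :=
  let: (a, b, c) := i in
  if (a == 0) && (b == 0) then lc_single idx1 else [::].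

(* S f = - f K, S E = - K^2 E, S K = K^2, extended anti-multiplicatively. *)
Definition antipode_mon (i : idx) : lcomb idx :=
  let: (a, b, c) := i in
  iter c (fun s => lc_bind mulK (lc_bind mulK s))
    (iter b (fun s => lc_opp (lc_bind mulK (lc_bind mulK (lc_bind mulE s))))
      (iter a (fun s => lc_opp (lc_bind mulF (lc_bind mulK s)))
        (lc_single idx1))).

(* Functions on idx are tabulated so that iterated convolutions share their
   intermediate results when evaluated. *)
Definition tab (T : Type) (f : idx -> seq T) : seq (idx * seq T) :=
  [seq (i, f i) | i <- all_idx].

Definition lookup (T : Type) (t : seq (idx * seq T)) (i : idx) : seq T :=
  foldr (fun u x => if u.1 == i then u.2 else x) [::] t.

Lemma lookup_tab T (f : idx -> seq T) i : lookup (tab f) i = f i.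
Proof.
have : i \in all_idx by apply: all_idxP i; vm_compute.
rewrite /lookup /tab; elim: all_idx => [//|j r IHr] /=.
by rewrite inE eq_sym; case: eqP => [->|_] //=.
Qed.

Definition conv_id_tab (D : seq (idx * lcomb (idx * idx)%type))
    (t : seq (idx * lcomb idx)) : seq (idx * lcomb idx) :=
  tab (fun i =>
    lc_bind (fun p : idx * idx => mulmon p.1 (lookup t p.2)) (lookup D i)).

Definition sweedler_tab (n : nat) : seq (idx * lcomb idx) :=
  let D := tab comul_mon in iter n (conv_id_tab D) (tab counit_mon).

(** The trace of S composed with the n-th Sweedler power, that is, the indicator of index n + 1. *)
Definition trace_val (n : nat) : eis :=
  let P := sweedler_tab n in
  let S := tab antipode_mon in
  foldr +%R 0 [seq lc_coef i (lc_bind (lookup S) (lookup P i)) | i <- all_idx].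

(** The convolution identity id * S = counit 1 for the candidate [antipode_mon], checked on
    monomials; [antipode_unique] then identifies the candidate with the antipode. *)
Lemma antipode_check :
  let T := conv_id_tab (tab comul_mon) (tab antipode_mon) in
  all (fun i => lc_vanishes (lookup T i ++ lc_opp (counit_mon i))) all_idx.
(* The heavy evaluation is run only once, by the kernel at [Qed]. *)
Proof. by vm_cast_no_check (erefl true). Qed.

(* The identity of H is killed by (x^3 - 1)^3 in the convolution algebra. *)
Definition recurrence_comb (s9 s6 s3 s0 : lcomb idx) : lcomb idx :=
  s9 ++ lc_opp (lc_scale (eis_int 3%:R) s6
    ++ lc_scale (eis_int (- 3%:R)) s3 ++ s0).

(** Expanded, the relation is P_9 = 3 P_6 - 3 P_3 + P_0, where P_0 is the convolution unit. *)
Lemma recurrence_check :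
  let P9 := sweedler_tab 9 in let P6 := sweedler_tab 6 in
  let P3 := sweedler_tab 3 in let P0 := sweedler_tab 0 in
  all (fun i => lc_vanishes (recurrence_comb (lookup P9 i) (lookup P6 i)
    (lookup P3 i) (lookup P0 i))) all_idx.
Proof. by vm_cast_no_check (erefl true). Qed.

(** The nine initial values; entry n of the check concerns the indicator of index n + 1. *)
Lemma trace_check :
  all (fun n => trace_val n == eis_int (n.+1 ^ 2)%:R) (iota 0 9).
Proof. by vm_cast_no_check (erefl true). Qed.

Lemma sum_all_idx (V : nmodType) (g : idx -> V) :
  \sum_(i <- all_idx) g i = \sum_i g i.
Proof.
rewrite [RHS]big_enum_val -big_enum_val /=.
apply: perm_big; apply: uniq_perm; rewrite ?index_enum_uniq //.
by move=> i; rewrite mem_index_enum; apply: all_idxP i; vm_compute.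
Qed.

(** * The indicators of u_q(sl_2) *)

Section UqSl2.

Variables (k : fieldType) (q : k) (H : hopfAlg k) (E F K : H).
Hypothesis hq : 3.-primitive_root q.
Hypothesis hH : is_uq_sl2 3 q E F K.

Let f : H := (q - q^-1) *: F.
Let hopf := hopfP H.
Let q2E := prim3_sqr hq.
Let rels : rescaled_relations q E f K :=
  rescale_relations hq (uq_rel (uq_pres hH)).

Notation mon := (mon E f K).
Notation val := (lc_val q mon).
Notation tmon := (fun p : idx * idx => tens (mon p.1) (mon p.2)).

Let K2K : K ^+ 2 * K = 1. Proof. by rewrite -exprSr (rr_K3 rels). Qed.

Let KK2 : K * K ^+ 2 = 1. Proof. by rewrite -exprS (rr_K3 rels). Qed.

Let K_unit : K \is a GRing.unit.
Proof. by apply/unitrP; exists (K ^+ 2). Qed.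

Let invK : K^-1 = K ^+ 2.
Proof. by apply: (mulrI K_unit); rewrite divrr // KK2. Qed.

Let mulK2_mon i : K ^+ 2 * mon i = val (lc_bind mulK (mulK i)).
Proof.
rewrite expr2 -mulrA (mulK_mon q2E rels).
exact: mulr_lc_val (mulK_mon q2E rels).
Qed.

Lemma comulX_val (x : H) (D : idx * idx -> lcomb (idx * idx)%type) n h s :
  (forall p, tens_mul (comul H x) (tmon p) = lc_val q tmon (D p)) ->
  comul H h = lc_val q tmon s ->
  comul H (x ^+ n * h) = lc_val q tmon (iter n (lc_bind D) s).
Proof.
move=> xD hs; elim: n => [|n IHn]; first by rewrite mul1r.
rewrite exprS -mulrA (comulM hopf) IHn.
apply: linear_lc_bind => //; exact: tens_mul_linearr.
Qed.

Lemma comul_monE i : comul H (mon i) = lc_val q tmon (comul_mon i).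
Proof.
have DK p : tens_mul (comul H K) (tmon p) = lc_val q tmon (mulDK p).
  by rewrite (uq_comulK hH) tens_mulE !(mulK_mon q2E rels) -lc_val_tens.
have DE p : tens_mul (comul H E) (tmon p) = lc_val q tmon (mulDE p).
  rewrite (uq_comulE hH) tens_mulDl !tens_mulE mul1r lc_val_cat !lc_val_tens //.
  by rewrite lc_val_single (mulK_mon q2E rels) !(mulE_mon q2E rels).
have DF p : tens_mul (comul H f) (tmon p) = lc_val q tmon (mulDF p).
  (* The scalar is absorbed into the factor F of each summand, so that f has coproduct f (x) K^-1 +
     1 (x) f. *)
  rewrite linearZ /= (uq_comulF hH) scalerDr -tensZl -tensZr.
  rewrite tens_mulDl !tens_mulE mul1r lc_val_cat !lc_val_tens //.
  by rewrite lc_val_single !(mulF_mon rels) invK mulK2_mon.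
case: i => [[a b] c].
(* The trailing 1 is where the iteration starts: its coproduct 1 (x) 1 is the single index
   [(idx1, idx1)]. *)
have -> : mon (a, b, c) = f ^+ a * (E ^+ b * (K ^+ c * 1)).
  by rewrite mulr1 mulrA.
do !apply: comulX_val => //.
by rewrite lc_val_single /= mon1 (comul1 hopf).
Qed.

(** The left counit axiom fixes e = counit on generators: e(K) K = K, e(F) K^-1 + F = F and e(E) 1 +
    e(K) E = E give e(K) = 1 and e(F) = e(E) = 0. *)
Lemma counit_monE i : counit H (mon i) *: 1 = val (counit_mon i).
Proof.
have eX (x : H) n : counit H (x ^+ n) = counit H x ^+ n.
  by elim: n => [|n IHn]; rewrite ?(counit1 hopf) // !exprS (counitM hopf) IHn.
have lift_counit (a b : H) :
    tens_lift (fun u v => counit H u *: v) (tens a b) = counit H a *: b.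
  rewrite tens_liftE //; split=> [v|u] c x y.
    by rewrite linearP /= scalerDl scalerA.
  by rewrite scalerDr !scalerA mulrC.
have K0 : K != 0 by apply: contraTneq K_unit => ->; rewrite unitr0.
have eK : counit H K = 1.
  have := counitl hopf K; rewrite (uq_comulK hH) lift_counit.
  move/eqP; rewrite -subr_eq0 -[X in _ - X]scale1r -scalerBl scaler_eq0.
  by rewrite (negPf K0) orbF subr_eq0 => /eqP.
have eF : counit H F = 0.
  have := counitl hopf F; rewrite (uq_comulF hH).
  rewrite -[tens F K^-1]scale1r tens_lift_is_linear scale1r !lift_counit.
  rewrite (counit1 hopf) scale1r => /eqP; rewrite -subr_eq0 addrK scaler_eq0.
  case/orP=> /eqP // K'0; have := K_unit.
  by rewrite -unitrV K'0 unitr0.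
have eE : counit H E = 0.
  have := counitl hopf E; rewrite (uq_comulE hH).
  rewrite -[tens E 1]scale1r tens_lift_is_linear scale1r !lift_counit.
  rewrite eK scale1r => /eqP; rewrite -subr_eq0 addrK scaler_eq0.
  by rewrite oner_eq0 orbF => /eqP.
case: i => [[a b] c].
have -> : mon (a, b, c) = f ^+ a * E ^+ b * K ^+ c by [].
rewrite !(counitM hopf) !eX eK expr1n mulr1.
rewrite linearZ /= eF eE scaler0.
case: a b => [[|a] lt_a] [[|b] lt_b];
  rewrite /= ?expr0 ?exprS ?mul0r ?mulr0 ?mul1r ?scale0r ?lc_val_nil //.
by rewrite lc_val_single mon1 scale1r.
Qed.

Lemma recurrence_comb_val s9 s6 s3 s0 :
  lc_vanishes (recurrence_comb s9 s6 s3 s0) ->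
  val s9 = 3%:R *: val s6 + (- 3%:R *: val s3 + val s0).
Proof.
move=> /(lc_val_vanishes q mon) s_eq0; apply/eqP.
have -> : - 3%:R = eis_val q (eis_int (- 3%:R)).
  by rewrite eis_val_int rmorphN rmorph_nat mulrNz mulrz_nat.
have -> : 3%:R = eis_val q (eis_int 3%:R) by rewrite eis_val_nat.
rewrite -!lc_val_scale // -!lc_val_cat -subr_eq0 -lc_val_opp // -lc_val_cat.
exact/eqP.
Qed.

Lemma conv_mon (g : 'End(H)) (t : idx -> lcomb idx) i :
  (forall j, g (mon j) = val (t j)) ->
  conv \1%VF g (mon i)
  = val (lc_bind (fun p => mulmon p.1 (t p.2)) (comul_mon i)).
Proof.
move=> gE; rewrite (conv_lc_val g (comul_monE i)) lc_val_bind //.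
by apply: eq_lc_val => p; rewrite gE (mulmon_val q2E rels).
Qed.

Lemma sweedler_pow_mon n i :
  sweedler_pow H n (mon i) = val (lookup (sweedler_tab n) i).
Proof.
elim: n i => [|n IHn] i; first by rewrite conv1E counit_monE lookup_tab.
rewrite [sweedler_pow _ _]iterS (conv_mon _ IHn).
by rewrite [sweedler_tab n.+1]iterS /conv_id_tab !lookup_tab.
Qed.

Lemma eq_on_mon (V : lmodType k) (g g' : H -> V) :
  linear g -> linear g' -> (forall i, g (mon i) = g' (mon i)) -> g =1 g'.
Proof.
move=> gL g'L gg' h; have [d [_ _ dE]] := mon_coordinates hq (uq_pres hH).
rewrite (dE h) !linear_scale_sum //.
by apply: eq_bigr => i _; rewrite gg'.
Qed.

Let End_linear (g : 'End(H)) : linear g.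
Proof. by move=> c x y; rewrite linearP. Qed.

Lemma antipode_monE i : antipode H (mon i) = val (antipode_mon i).
Proof.
have [d [dL dmon dE]] := mon_coordinates hq (uq_pres hH).
(* The linear extension of the candidate antipode from the monomials to H. *)
pose t h : H := \sum_j d j h *: val (antipode_mon j).
have tL : linear t.
  move=> c x y; rewrite /t scaler_sumr -big_split; apply: eq_bigr => j _ /=.
  by rewrite dL scalerDl scalerA.
pose tl := HB.pack_for {linear H -> H} t (GRing.isLinear.Build _ _ _ _ t tL).
have TE j : linfun tl (mon j) = val (antipode_mon j).
  rewrite lfunE /= /t (bigD1 j) //= dmon eqxx scale1r big1 ?addr0 // => l.
  by rewrite eq_sym dmon => /negPf->; rewrite scale0r.
rewrite (@antipode_unique _ _ (linfun tl)) ?TE // => {i}.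
apply: eq_on_mon => [||i]; first exact: End_linear.
  by move=> c x y; rewrite linearP /= scalerDl scalerA.
have TE' j : linfun tl (mon j) = val (lookup (tab antipode_mon) j).
  by rewrite TE lookup_tab.
rewrite counit_monE (conv_mon _ TE'); apply/eqP.
rewrite -subr_eq0 -lc_val_opp // -lc_val_cat lc_val_vanishes //.
by have := all_idxP antipode_check i; rewrite /conv_id_tab !lookup_tab.
Qed.

(** The case n = 0 is checked on monomials; convolving with id on the left, which is linear, gives
    the step from n to n + 1. *)
Lemma sweedler_pow_recurrence n h :
  sweedler_pow H (n + 9) h
  = 3%:R *: sweedler_pow H (n + 6) h
    + (- 3%:R *: sweedler_pow H (n + 3) h + sweedler_pow H n h).
Proof.
elim: n h => [|n IHn] h; last first.
  rewrite !addSn /sweedler_pow !iterS -!/(sweedler_pow H _) !convE.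
  rewrite -!tens_lift_lin; apply: eq_tens_lift => u v.
  by rewrite IHn !mulrDr -!scalerAr.
rewrite !add0n.
pose g : 'End(H) := 3%:R *: sweedler_pow H 6
  + (- 3%:R *: sweedler_pow H 3 + sweedler_pow H 0).
have gE x : g x = 3%:R *: sweedler_pow H 6 x
    + (- 3%:R *: sweedler_pow H 3 x + sweedler_pow H 0 x).
  by rewrite add_lfunE scale_lfunE add_lfunE scale_lfunE.
rewrite -gE; move: h; apply: eq_on_mon => [||i]; try exact: End_linear.
rewrite gE 4!sweedler_pow_mon; apply: recurrence_comb_val.
exact: (all_idxP recurrence_check i).
Qed.

Let nu_coef (d : idx -> H -> k^o) n :
  (forall i, linear (d i)) -> (forall v, v = \sum_i d i v *: mon i) ->
  nu H n.+1 = \sum_i d i (antipode H (sweedler_pow H n (mon i))).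
Proof.
move=> dL dE; rewrite /nu (lfun_traceE _ dL dE).
by apply: eq_bigr => i _; rewrite comp_lfunE.
Qed.

Lemma nu_trace_val n : nu H n.+1 = eis_val q (trace_val n).
Proof.
have [d [dL dmon dE]] := mon_coordinates hq (uq_pres hH).
rewrite (nu_coef n dL dE) -sum_all_idx /trace_val.
elim: all_idx => [|i r IHr]; first by rewrite big_nil eis_val0.
rewrite big_cons IHr /= eis_valD; congr (_ + _).
rewrite -(lc_val_coef (b := mon) q _ (dL i)); last by move=> j; rewrite dmon.
rewrite sweedler_pow_mon; congr (d i _).
by apply: linear_lc_bind => // j; rewrite antipode_monE lookup_tab.
Qed.

Lemma nu_recurrence n :
  nu H (n + 9).+1
  = 3%:R * nu H (n + 6).+1 - 3%:R * nu H (n + 3).+1 + nu H n.+1.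
Proof.
have [d [dL dmon dE]] := mon_coordinates hq (uq_pres hH).
rewrite !(nu_coef _ dL dE) -mulNr !mulr_sumr -!big_split.
apply: eq_bigr => i _ /=; rewrite sweedler_pow_recurrence !linearP /= !dL.
by rewrite addrA.
Qed.

Lemma nu_sqr n : nu H n.+1 = (n.+1 ^ 2)%:R.
Proof.
elim/ltn_ind: n => n IHn; have [n9|n9] := ltnP n 9.
  rewrite nu_trace_val (eqP (allP trace_check n _)) ?eis_val_nat //.
  by rewrite mem_iota.
rewrite -(subnK n9) nu_recurrence !IHn; [|lia..].
(* The third difference with step 3 of a quadratic polynomial vanishes, so squares obey the same
   recurrence. *)
by rewrite !natrX -!natr1 !natrD; ring.
Qed.

End UqSl2.

Theorem proposition6p10 (k : closedFieldType) (hk : [pchar k] =i pred0)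
    (q : k) (hq : 3.-primitive_root q)
    (H : hopfAlg k) (E F K : H) (hH : is_uq_sl2 3 q E F K)
    (n : nat) (hn : (1 <= n)%N) :
  nu H n = (n ^ 2)%:R.
Proof. by case: n hn => // n _; apply: nu_sqr hH n. Qed.
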